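(* Let $G$ be a finite group and $L_A(G)=\{H\in L(G): H \text{ is abelian}\}$. If $S=(G\times G)\sqcup L_A(G)$, then \[ \Pr(G)=\frac{\sum_{H\in L_A(G)}\deg_{\mathcal{B}(G)[S]}(H)}{|G|^2}=\frac{|e(\mathcal{B}(G)[S])|}{|G|^2}. \]
   Context: For a group $G$, let $L(G)$ be the set of all subgroups of $G$. The graph $\mathcal{B}(G)$ is the simple undirected bipartite graph with vertex set the disjoint union $V(\mathcal{B}(G)) = (G\times G) \sqcup L(G)$, in which $(a,b)\in G\times G$ and $H \in L(G)$ are adjacent if and only if $H = \langle a,b\rangle$, and there are no other edges. For $S\subseteq V(\mathcal{B}(G))$, $\mathcal{B}(G)[S]$ is the subgraph of $\mathcal{B}(G)$ induced by $S$; $e(\Gamma)$ is the edge set of a graph $\Gamma$ and $\deg_\Gamma$ the degree in $\Gamma$. $\Pr(G)=\dfrac{|\{(a,b)\in G\times G: ab=ba\}|}{|G|^2}$ is the commuting probability of $G$. *)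

(* Defs.v *)
From mathcomp Require Import all_boot all_order all_algebra all_fingroup.
Set Implicit Arguments.
Unset Strict Implicit.
Unset Printing Implicit Defensive.
Import GroupScope GRing.Theory.

Record sgraph (T : finType) := SGraph {
  vertices : {set T};
  adj : rel T;
  adj_sym : symmetric adj;
  adj_irr : irreflexive adj;
  adj_vertex : forall x y, adj x y -> x \in vertices
}.

Section SimpleGraph.
Variable T : finType.
Implicit Types (g : sgraph T) (S : {set T}).

Definition edges g : {set {set T}} :=
  [set e | [exists x, exists y, adj g x y && (e == [set x; y])]].

Definition deg g (x : T) : nat := #|[set y | adj g x y]|.

Definition induced_adj g S : rel T :=
  fun x y => [&& x \in S, y \in S & adj g x y].

Lemma induced_adj_sym g S : symmetric (induced_adj g S).
Proof. by move=> x y; rewrite /induced_adj adj_sym andbCA. Qed.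

Lemma induced_adj_irr g S : irreflexive (induced_adj g S).
Proof. by move=> x; rewrite /induced_adj adj_irr !andbF. Qed.

Lemma induced_adj_vertex g S x y :
  induced_adj g S x y -> x \in vertices g :&: S.
Proof. by case/and3P=> xS _ /adj_vertex xV; rewrite inE xV xS. Qed.

Definition induced g S : sgraph T :=
  SGraph (@induced_adj_sym g S) (@induced_adj_irr g S)
         (@induced_adj_vertex g S).

End SimpleGraph.

Section SubgroupGeneratingGraph.
Variable gT : finGroupType.
Implicit Types (G H : {group gT}).

(* The ambient type of the vertices; those of B(G) form the subset
   (G x G) + L(G), where L(G) is the library's subgroups G. *)
Definition vertexT : finType := ((gT * gT) + {group gT})%type.

Definition vertex_union (P : {set gT * gT}) (L : {set {group gT}}) :
    {set vertexT} :=
  [set x : vertexT | match x with inl p => p \in P | inr H => H \in L end].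

Definition gen_pair G (p : gT * gT) H : bool :=
  [&& p \in setX G G, H \in subgroups G & H :==: <<[set p.1; p.2]>>].

Definition Badj G : rel vertexT := fun x y =>
  match x, y with
  | inl p, inr H | inr H, inl p => gen_pair G p H
  | _, _ => false
  end.

Lemma Badj_sym G : symmetric (Badj G).
Proof. by case=> [p|H] [q|K]. Qed.

Lemma Badj_irr G : irreflexive (Badj G).
Proof. by case. Qed.

Lemma Badj_vertex G x y :
  Badj G x y -> x \in vertex_union (setX G G) (subgroups G).
Proof. by case: x y => [p|H] [q|K] //= /and3P[pG HG _]; rewrite inE. Qed.

Definition Bgraph G : sgraph vertexT :=
  SGraph (@Badj_sym G) (@Badj_irr G) (@Badj_vertex G).

Definition abelian_subgroups G : {set {group gT}} :=
  [set H in subgroups G | abelian H].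

Definition commuting_pairs G : {set gT * gT} :=
  [set p in setX G G | p.1 * p.2 == p.2 * p.1].

Definition commuting_prob G : rat :=
  (#|commuting_pairs G|%:R / #|G|%:R ^+ 2)%R.

End SubgroupGeneratingGraph.

(* Main.v *)
(** Since <a, b> is abelian exactly when a and b commute, each commuting pair
    has exactly one neighbour in B(G)[S], namely <a, b>, and every other pair is
    isolated.  Counting the commuting pairs by the subgroup they generate gives
    the degree sum, and sending a pair to its unique edge gives the edge
    count. *)
Require Import Defs.
From mathcomp Require Import all_boot all_order all_algebra all_fingroup.
Import GroupScope GRing.Theory.
Local Open Scope ring_scope.

Definition gen_group {gT : finGroupType} (p : gT * gT) : {group gT} :=
  <<[set p.1; p.2]>>%G.

Definition edge_of_pair {gT : finGroupType} (p : gT * gT) : {set vertexT gT} :=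
  [set inl p; inr (gen_group p)].

(** A generated subgroup is abelian once its generators commute pairwise, and a generator always
    commutes with itself. *)
Lemma abelian_gen_group {gT : finGroupType} (p : gT * gT) :
  abelian (gen_group p) = (p.1 * p.2 == p.2 * p.1)%g.
Proof.
rewrite abelian_gen; apply/centsP/eqP => [cab | cab x /set2P[]-> y /set2P[]->] //.
by apply: cab; rewrite !inE eqxx ?orbT.
Qed.

Lemma gen_group_sub {gT : finGroupType} (G : {group gT}) (p : gT * gT) :
  (gen_group p \in subgroups G) = (p \in setX G G).
Proof. by case: p => a b; rewrite inE gen_subG subUset !sub1set in_setX. Qed.

Section AbelianInducedGraph.
Context {gT : finGroupType} (G : {group gT}).

Let BS := induced (Bgraph G) (vertex_union (setX G G) (abelian_subgroups G)).

(** Once [H] is the subgroup generated by [p], its membership in [abelian_subgroups G] reduces to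
    conditions on [p]. Adjacency is thus the graph of [gen_group] on commuting pairs. *)
Lemma adj_abelianE (p : gT * gT) (H : {group gT}) :
  adj BS (inl p) (inr H) = (p \in commuting_pairs G) && (gen_group p == H).
Proof.
rewrite /= /induced_adj /= /gen_pair ![_ \in vertex_union _ _]inE.
rewrite !in_set -/(gen_group p).
(* Groups are compared through their underlying sets, so only the orientation changes. *)
have -> : (H :==: <<[set p.1; p.2]>>) = (gen_group p == H) by rewrite eq_sym.
case: eqP => [<-|_]; last by rewrite !andbF.
have:= gen_group_sub G p; rewrite inE => ->; rewrite abelian_gen_group !andbT.
rewrite !inE.
by case: (p.1 \in G); case: (p.2 \in G); case: eqP.
Qed.

Lemma gen_group_abelian_subgroup (p : gT * gT) :
  p \in commuting_pairs G -> gen_group p \in abelian_subgroups G.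
Proof.
rewrite inE => /andP[pG cp].
by rewrite inE gen_group_sub pG abelian_gen_group.
Qed.

(** By bipartiteness, the neighbours of [H] are the [inl]-image of the fibre of [gen_group] over
    [H]. *)
Lemma deg_abelianE (H : {group gT}) :
  deg BS (inr H) = #|[set p in commuting_pairs G | gen_group p == H]|.
Proof.
have inl_inj : injective (@inl (gT * gT) {group gT}) by move=> p q [].
rewrite -(card_imset _ inl_inj) /deg; apply: eq_card => y.
rewrite inE adj_sym; apply/idP/imsetP => [|[p]].
  case: y => [p|K]; last by rewrite /= /induced_adj /= !andbF.
  by rewrite adj_abelianE => pH; exists p; rewrite // inE.
by rewrite inE -adj_abelianE => pH ->.
Qed.

Lemma sum_deg_abelian :
  (\sum_(H in abelian_subgroups G) deg BS (inr H))%N = #|commuting_pairs G|.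
Proof.
rewrite -sum1_card (partition_big _ _ gen_group_abelian_subgroup) /=.
by apply: eq_bigr => H _; rewrite deg_abelianE sum1dep_card.
Qed.

(** The pair is recovered as the only [inl] vertex of its edge. *)
Lemma edge_of_pair_inj : injective (edge_of_pair (gT := gT)).
Proof.
move=> p q eq_pq.
have: inl p \in edge_of_pair q by rewrite -eq_pq !inE eqxx.
by rewrite !inE orbF => /eqP[].
Qed.

Lemma edges_abelianE : edges BS = edge_of_pair @: commuting_pairs G.
Proof.
have edgeP p H : adj BS (inl p) (inr H) ->
    [set inl p; inr H] \in edge_of_pair @: commuting_pairs G.
  by rewrite adj_abelianE => /andP[pG /eqP <-]; apply: imset_f.
apply/setP=> e; apply/idP/imsetP => [|[p pG ->]].
  rewrite inE => /existsP[x /existsP[y /andP[xy /eqP->]]]; apply/imsetP.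
  (* Edges are unordered, so either endpoint may be the pair; two endpoints on the same side are
     never adjacent. *)
  case: x y xy => [p|H] [q|K].
  - by rewrite /= /induced_adj /= !andbF.
  - exact: edgeP.
  - by rewrite adj_sym setUC; apply: edgeP.
  - by rewrite /= /induced_adj /= !andbF.
rewrite inE; apply/existsP; exists (inl p).
apply/existsP; exists (inr (gen_group p)).
by rewrite adj_abelianE pG !eqxx.
Qed.

Lemma card_edges_abelian : #|edges BS| = #|commuting_pairs G|.
Proof. by rewrite edges_abelianE (card_imset _ edge_of_pair_inj). Qed.

End AbelianInducedGraph.

Theorem theorem3p4 (gT : finGroupType) (G : {group gT}) :
  let S := vertex_union (setX G G) (abelian_subgroups G) in
  let BS := induced (Bgraph G) S in
  commuting_prob G =
    (\sum_(H in abelian_subgroups G) deg BS (inr H))%N%:R / #|G|%:R ^+ 2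
  /\ (\sum_(H in abelian_subgroups G) deg BS (inr H))%N%:R / #|G|%:R ^+ 2 =
    #|edges BS|%:R / #|G|%:R ^+ 2 :> rat.
Proof. by move=> S BS; rewrite sum_deg_abelian card_edges_abelian. Qed.
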